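(* For a set $X\subseteq\mathbb R$, consider: (1) $X$ is an $A_3$-set; (2) for every sequence $(\mathfrak U_1,\mathfrak U_2,\dots)$ such that each $\mathfrak U_n$ is a collection of countably many Borel subsets of $\mathbb R$ whose union contains $X$, there is a sequence $(\mathcal V_1,\mathcal V_2,\dots)$ with each $\mathcal V_n$ a finite subset of $\mathfrak U_n$ and $X\subseteq\bigcup_{n=1}^\infty\bigcup\mathcal V_n$; (3) for every Borel function $\Psi:X\to{}^{\omega}\omega$, the image $\Psi[X]$ has property $M$; (4) for no Borel function $\Psi:X\to{}^{\omega}\omega$ is $\Psi[X]$ a dominating family; (5) $X$ has property $M$. Then (1), (2), (3) and (4) are equivalent, and each of them implies (5).
   Context: $X\subseteq\mathbb R$ is an $A_3$-set if for every sequence $(\mathfrak U_1,\mathfrak U_2,\dots)$ such that each $\mathfrak U_n$ is a countable chain (linearly ordered by inclusion) of Borel subsets of $\mathbb R$ with $X\subseteq\bigcup\mathfrak U_n$, there is a sequence $(Y_1,Y_2,\dots)$ with $Y_n\in\mathfrak U_n$ for each $n$ and $X\subseteq\bigcup_n Y_n$. A function $\Psi:X\to{}^{\omega}\omega$ (Baire space with the product topology) is Borel if the preimage of every open set is of the form $X\cap B$ with $B\subseteq\mathbb R$ Borel. A family $D\subseteq{}^\omega\omega$ is dominating if for every $g\in{}^\omega\omega$ there is $f\in D$ with $g(n)\le f(n)$ for all but finitely many $n$. A space $Y$ has property $M$ (Menger) if for every sequence $(\mathfrak G_n)_{n<\omega}$ such that each $\mathfrak G_n$ is a chain of open sets covering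 $Y$, there are $F_n\in\mathfrak G_n$ such that $\{F_n:n<\omega\}$ covers $Y$. *)

(* Defs.v *)
From HB Require Import structures.
From mathcomp Require Import all_boot all_order all_algebra.
From mathcomp Require Import all_classical all_reals all_analysis.
Import numFieldNormedType.Exports.

Set Implicit Arguments.
Unset Strict Implicit.
Unset Printing Implicit Defensive.

Local Open Scope classical_set_scope.

Definition borel_set (T : topologicalType) : set (set T) := <<s @open T >>.

Definition baire : topologicalType := {ptws nat -> nat}.

(* Chains are nonempty by convention. For a chain covering a nonempty set this
   is automatic; it only matters over the empty set, which the empty family
   covers although no member can be selected from it. *)
Definition is_chain (T : Type) (C : set (set T)) : Prop :=
  C !=set0 /\ total_on C subset.

Definition menger (Y : topologicalType) : Prop :=
  forall G : nat -> set (set Y),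
    (forall n, [/\ is_chain (G n), G n `<=` open
                 & [set: Y] `<=` \bigcup_(A in G n) A]) ->
    exists F : nat -> set Y,
      (forall n, G n (F n)) /\ [set: Y] `<=` \bigcup_n F n.

Definition A3_set (R : realType) (X : set R) : Prop :=
  forall U : nat -> set (set R),
    (forall n, [/\ is_chain (U n), countable (U n), U n `<=` @borel_set R
                 & X `<=` \bigcup_(A in U n) A]) ->
    exists Y : nat -> set R,
      (forall n, U n (Y n)) /\ X `<=` \bigcup_n Y n.

Definition borel_finite_selection (R : realType) (X : set R) : Prop :=
  forall U : nat -> set (set R),
    (forall n, [/\ countable (U n), U n `<=` @borel_set R
                 & X `<=` \bigcup_(A in U n) A]) ->
    exists V : nat -> set (set R),
      (forall n, finite_set (V n) /\ V n `<=` U n) /\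
      X `<=` \bigcup_n \bigcup_(A in V n) A.

(* The domain is the subtype of elements of [X]; the preimage of [W] is pushed
   back into [R] along the inclusion [set_val]. *)
Definition borel_function (R : realType) (X : set R) (Psi : X -> baire) : Prop :=
  forall W : set baire, open W ->
    exists2 B : set R, borel_set B & set_val @` (Psi @^-1` W) = X `&` B.

Definition dominating (D : set baire) : Prop :=
  forall g : baire, exists2 f : baire,
    D f & \forall n \near \oo, (g n <= f n)%N.

(* [set_type A] carries the topology induced from the ambient space. *)
Definition borel_images_menger (R : realType) (X : set R) : Prop :=
  forall Psi : X -> baire, borel_function Psi -> menger (set_type (range Psi)).

Definition borel_images_not_dominating (R : realType) (X : set R) : Prop :=
  forall Psi : X -> baire, borel_function Psi -> ~ dominating (range Psi).

(* Main.v *)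
(** From a countable Borel cover [U n] one passes to the chain of its finite
    unions, so (1) gives (2). A Borel image of [X] in a second-countable space
    inherits the Menger property from (2) by pulling back the basic open sets
    that refine a given chain: a finite selection of them lies below a single
    member of the chain. This gives (3) for the Baire space, and (5) for the
    inclusion of [X] into the line. If a set of sequences [f] is Menger, the
    chains [{f n <= k}]_k, used from every starting index on, produce a [g]
    that each [f] stays below infinitely often, so the set is not dominating.
    Finally, given chains [U n] enumerated as [A n 0], [A n 1], and so on, let
    [Psi x n] be the first [i] with [x] in [A n i]; a [g] witnessing that
    [Psi] is not dominating tells how far to go in each [U n]. *)
Require Import Defs.
From mathcomp Require Import all_boot all_order all_algebra.
From mathcomp Require Import all_classical all_reals all_analysis.
Import numFieldNormedType.Exports.
Import Order.TTheory GRing.Theory Num.Theory.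

Set Implicit Arguments.
Unset Strict Implicit.
Unset Printing Implicit Defensive.

Local Open Scope classical_set_scope.

(** * Chains and countable families *)

Lemma chain_finite_ub (T : Type) (C F : set (set T)) :
  is_chain C -> finite_set F -> F `<=` C ->
  exists2 M, C M & forall A, F A -> A `<=` M.
Proof.
move=> [[A0 CA0] totC] /finite_seqP[s ->].
(* The empty family is bounded by [A0], which exists because chains are nonempty. *)
elim: s => [_|A s IHs sC]; first by exists A0.
have [|M CM ubM] := IHs.
  by move=> B sB; apply: sC; rewrite /= inE sB orbT.
have CA : C A by apply: sC; rewrite /= inE eqxx.
have [AM|MA] := totC _ _ CA CM.
  by exists M => // B; rewrite /= inE => /orP[/eqP->//|/ubM].
exists A => // B; rewrite /= inE => /orP[/eqP->//|/ubM BM].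
exact: subset_trans MA.
Qed.

Lemma countable_range (T : Type) (C : set T) :
  countable C -> C !=set0 -> exists A : nat -> T, range A = C.
Proof.
move=> /pfcard_geP[->[]//|[f]] _; exists f.
exact: image_eq.
Qed.

(** * Closure properties of the Borel sets of the line *)

Section BorelSets.
Variable R : realType.

Lemma borel_set_bigcup (I : countType) (D : set I) (F : I -> set R) :
  (forall i, D i -> borel_set (F i)) -> borel_set (\bigcup_(i in D) F i).
Proof.
move=> mF; rewrite bigcup_mkcond.
apply: (@countable_bigcupT_measurable _ (g_sigma_algebraType (@open R))) => // i.
by case: ifPn => [/set_mem/mF//|_]; exact: (@sigma_algebra0 _ setT open).
Qed.

Lemma borel_setD (A B : set R) :
  borel_set A -> borel_set B -> borel_set (A `\` B).
Proof. exact: (@measurableD _ (g_sigma_algebraType (@open R))). Qed.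

Lemma borel_set_bigcap (D : set nat) (F : nat -> set R) :
  (forall i, D i -> borel_set (F i)) -> borel_set (\bigcap_(i in D) F i).
Proof.
exact: (@bigcap_measurableType _ (g_sigma_algebraType (@open R))).
Qed.

End BorelSets.

(** * Countable bases and Borel functions into the Baire space *)

Definition cylinder (s : seq nat) : set baire :=
  [set f | forall i, (i < size s)%N -> f i = nth 0%N s i].

Lemma baire_coord_open (n : nat) (P : set nat) :
  open [set f : baire | P (f n)].
Proof.
have /continuousP : continuous (fun f : baire => f n : nat).
  exact: (@proj_continuous nat (fun=> nat) n).
by move=> /(_ P); apply; exact: discrete_open.
Qed.

Lemma cylinder_open (s : seq nat) : open (cylinder s).
Proof.
elim/last_ind: s => [|s k IHs].
  by rewrite (_ : cylinder _ = setT); [exact: openT|apply/seteqP; split].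
rewrite (_ : cylinder (rcons s k) = cylinder s `&` [set f | [set k] (f (size s))]).
  by apply: openI => //; exact: baire_coord_open.
rewrite eqEsubset; split=> [f fs|f [fs fk] i].
  split=> [i iles|/=].
    by rewrite fs ?size_rcons ?ltnS 1?ltnW// nth_rcons iles.
  by rewrite fs ?size_rcons// nth_rcons ltnn eqxx.
rewrite size_rcons ltnS leq_eqVlt nth_rcons => /orP[/eqP->|ils].
  by rewrite ltnn eqxx.
by rewrite ils; exact: fs.
Qed.

(** The sets of sequences agreeing with [f] below [N] generate a filter converging to [f]
    coordinatewise, hence in the product topology. So [W] contains one of them, and each is a
    cylinder. *)
Lemma open_cylinder (W : set baire) (f : baire) : open W -> W f ->
  exists2 s, cylinder s f & cylinder s `<=` W.
Proof.
move=> oW Wf.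
pose cyl N := [set h : {ptws nat -> nat} | forall i, (i < N)%N -> h i = f i].
pose F := filter_from [set: nat] cyl.
have FF : Filter F.
  apply: filter_from_filter; first by exists 0%N.
  move=> i j _ _; exists (maxn i j) => // h hij.
  by split=> k kl; apply: hij; rewrite leq_max kl ?orbT.
have /pointwise_cvgP : forall t : nat,
    (fun g : {ptws nat -> nat} => g t) @ F --> f t.
  move=> t A /= At; exists t.+1 => // h /(_ t (ltnSn t)) /= ->.
  exact: nbhs_singleton.
move=> /(_ W) [|N _ NW]; first exact: open_nbhs_nbhs.
exists (mkseq f N) => [i|h hN].
  by rewrite size_mkseq => iN; rewrite nth_mkseq.
apply: NW => i iN; rewrite hN ?size_mkseq//.
by rewrite nth_mkseq.
Qed.

Lemma baire_second_countable : @second_countable baire.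
Proof.
exists (range cylinder).
  exact: sub_countable (card_image_le _ _) (countableP _).
split=> [_ [s _ <-]|f A /=]; first exact: cylinder_open.
rewrite nbhsE => -[W [oW Wf] WA].
have [s sf sW] := open_cylinder oW Wf.
by exists (cylinder s) => /=; [split=> //; exists s|exact: subset_trans WA].
Qed.

Lemma real_second_countable (R : realType) : @second_countable R.
Proof.
pose itv (pq : rat * rat) : set R := `]ratr pq.1, ratr pq.2[%classic.
exists (range itv).
  exact: sub_countable (card_image_le _ _) (countableP _).
split=> [_ [s _ <-]|x A /=]; first exact: itv_open.
move=> /nbhs_ballP[e /= e0 eA].
have /rat_in_itvoo[p] : (x - e < x)%R by rewrite ltrBlDr ltrDl.
have /rat_in_itvoo[q] : (x < x + e)%R by rewrite ltrDl.
rewrite !in_itv /= => /andP[xq qe] /andP[ep px].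
exists (itv (p, q)) => /=.
  by split; [exists (p, q)|rewrite /itv/= in_itv/= px xq].
move=> y; rewrite /itv/= in_itv/= => /andP[py yq]; apply: eA.
rewrite /ball/= ltr_distlC; apply/andP; split.
  exact: lt_trans ep py.
exact: lt_trans yq qe.
Qed.

(** An open [W] is the union of the cylinders inside it. These are indexed by finite words, so the
    preimage is a countable union of finite intersections of coordinate fibres, each the trace on
    [X] of some [E n k]. *)
Lemma borel_function_coord (R : realType) (X : set R) (Psi : X -> baire)
    (E : nat -> nat -> set R) :
  (forall n k, borel_set (E n k)) ->
  (forall x n k, Psi x n = k <-> E n k (set_val x)) ->
  borel_function Psi.
Proof.
move=> mE PsiE W oW.
exists (\bigcup_(s in [set s | cylinder s `<=` W])
          \bigcap_(i in `I_(size s)) E i (nth 0%N s i)).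
  by apply: borel_set_bigcup => s _; apply: borel_set_bigcap.
rewrite eqEsubset; split=> [_ [x /= Wx <-]|r [Xr [s /= sW sr]]].
  split; first exact: set_valP.
  have [s sx sW] := open_cylinder oW Wx.
  by exists s => //= i /= il; apply/PsiE; exact: sx.
exists (exist _ r (mem_set Xr)) => //=; apply: sW => i il.
by apply/PsiE; exact: sr.
Qed.

(** * Implications between selection principles and non-domination *)

Lemma menger_not_dominating (D : set baire) :
  menger (set_type D) -> ~ dominating D.
Proof.
move=> mD domD.
pose le n k := [set y : set_type D | (set_val y n <= k)%N].
have ole n k : open (le n k).
  exists [set f : baire | (f n <= k)%N] => //.
  exact: (baire_coord_open n [set i | (i <= k)%N]).
(* One selection bounds [f] at a single coordinate only; a selection from every start [m] yields
   such coordinates arbitrarily far out. *)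
have /choice[h hP] : forall m, exists h : nat -> nat,
    forall f, D f -> exists j, (f (m + j) <= h j)%N.
  move=> m; have [|F [GF coverF]] := mD (fun j => range (le (m + j)%N)).
    move=> j; split; last 1 first.
    - move=> y _; exists (le (m + j)%N (set_val y (m + j)%N)) => //.
      exact: leqnn.
    - split; first by exists (le (m + j)%N 0%N); exists 0%N.
      move=> _ _ [k _ <-] [l _ <-]; have [kl|lk] := leqP k l; [left|right].
        by move=> y /= /leq_trans; exact.
      by move=> y /= /leq_trans; apply; exact: ltnW.
    - by move=> _ [k _ <-].
  have /choice[h hP] : forall j, exists k, le (m + j)%N k = F j.
    by move=> j; have [k _ <-] := GF j; exists k.
  exists h => f Df; have [j _] := coverF (exist _ f (mem_set Df)) I.
  by rewrite -hP => fj; exists j.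
(* This diagonal maximum exceeds [h m (n - m)] for all [m <= n]; the successor makes it strict, so
   [f (N + j) <= h N j] contradicts domination past [N]. *)
have [f Df [N _ gf]] := domD (fun n => (\max_(m < n.+1) h m (n - m)%N).+1).
have [j fj] := hP N f Df.
have := gf (N + j)%N (leq_addr _ _); rewrite ltnNge => /negP; apply.
apply: leq_trans fj _.
have Nj : (N < (N + j).+1)%N by rewrite ltnS leq_addr.
by rewrite (leq_trans _ (leq_bigmax (Ordinal Nj)))//= addKn.
Qed.

(** The target is left general so as to cover both Borel maps into the Baire space and the inclusion
    of [X] into the line. *)
Lemma finite_selection_image_menger (R : realType) (X : set R)
    (T : topologicalType) (Psi : X -> T) :
  @second_countable T ->
  (forall W, open W ->
     exists2 B : set R, borel_set B & set_val @` (Psi @^-1` W) = X `&` B) ->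
  borel_finite_selection X -> menger (set_type (range Psi)).
Proof.
move=> [base cbase [obase baseP]] Psi_borel selX G GP.
(* The chains consist of sets open in the image only, so basic open sets of [T] are compared with
   them through their traces. *)
pose D n := [set W | base W /\
  exists2 A, G n A & (set_val : range Psi -> T) @^-1` W `<=` A].
have /choice[B BP] : forall W : set T, exists B : set R, open W ->
    borel_set B /\ set_val @` (Psi @^-1` W) = X `&` B.
  move=> W; have [/Psi_borel[B mB WB]|nW] := pselect (open W); last by exists set0.
  by exists B.
have PsiB x W : open W -> W (Psi x) <-> B W (set_val x).
  move=> /BP[_ WB]; split=> [Wx|BWx].
    have [] : (X `&` B W) (set_val x) by rewrite -WB; exists x.
    by [].
  have : (X `&` B W) (set_val x) by split=> //; exact: set_valP.
  by rewrite -WB => -[x' Wx' /val_inj <-].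
have [|V [VP coverV]] := selX (fun n => B @` D n).
  move=> n; have [chG oG coverG] := GP n; split.
  - apply: card_le_trans (card_image_le _ _) _.
    by apply: sub_countable cbase; apply: subset_card_le => W [].
  - by move=> _ [W [/obase/BP[mB _] _] <-].
  move=> r Xr; pose x : X := exist _ r (mem_set Xr).
  have rx : range Psi (Psi x) by exists x.
  have [A GA Ax] := coverG (exist _ (Psi x) (mem_set rx)) I.
  have [Q oQ QA] := oG A GA; move: Ax; rewrite -QA => /= Qx.
  have [W [bW Wx] WQ] := baseP (Psi x) Q (open_nbhs_nbhs (conj oQ Qx)).
  exists (B W); last by apply/(PsiB x) => //; exact: obase.
  exists W => //; split=> //; exists A => // y Wy; rewrite -QA; exact: WQ.
(* Each selected Borel set [C] gets a chain member above the trace of a basic set pulling back to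
   it; outside [V n] any member of [G n] serves. *)
have /choice[A AP] : forall nC : nat * set R, exists A, G nC.1 A /\
    (V nC.1 nC.2 -> exists W,
       [/\ open W, B W = nC.2 & (set_val : range Psi -> T) @^-1` W `<=` A]).
  move=> [n C] /=; have [VC|nVC] := pselect (V n C); last first.
    by have [[[A GA] _] _ _] := GP n; exists A.
  have [W [bW [A GA WA]] BW] := (VP n).2 _ VC.
  by exists A; split=> // _; exists W; split=> //; exact: obase.
have /choice[F FP] : forall n, exists M,
    G n M /\ forall C, V n C -> A (n, C) `<=` M.
  move=> n; have [chG _ _] := GP n; have [fV _] := VP n.
  have [||M GM ubM] := chain_finite_ub (F := (fun C => A (n, C)) @` V n) chG.
  - exact: finite_image.
  - by move=> _ [C _ <-]; have [] := AP (n, C).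
  by exists M; split=> // C VC; apply: ubM; exists C.
exists F; split=> [n|y _]; first by have [] := FP n.
have [x _ xy] : range Psi (set_val y) := set_valP y.
have [n _ [C VC Cx]] := coverV _ (set_valP x).
have [_ /(_ VC)[W [oW /= BW WA]]] := AP (n, C).
have Wy : W (set_val y) by rewrite -xy; apply/PsiB; rewrite ?BW.
by exists n => //; apply: (FP n).2 VC _ _; exact: WA.
Qed.

Lemma borel_finite_selection_menger (R : realType) (X : set R) :
  borel_finite_selection X -> menger (set_type X).
Proof.
(* Viewing [X] as the range of its inclusion reduces the claim to the lemma on images. *)
move=> selX; have <- : range (set_val : X -> R) = X.
  rewrite eqEsubset; split=> [_ [x _ <-]|r Xr]; first exact: set_valP.
  by exists (exist _ r (mem_set Xr)).
apply: finite_selection_image_menger selX; first exact: real_second_countable.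
move=> W oW; exists W; first exact: sub_sigma_algebra.
rewrite eqEsubset; split=> [_ [x /= Wx <-]|r [Xr Wr]].
  by split=> //; exact: set_valP.
by exists (exist _ r (mem_set Xr)).
Qed.

Lemma A3_finite_selection (R : realType) (X : set R) :
  A3_set X -> borel_finite_selection X.
Proof.
move=> A3X U UP.
have /choice[idx idxP] : forall n, exists idx : set R -> nat,
    {in U n &, injective idx}.
  by move=> n; have [/countable_injP] := UP n.
(* An injective numbering, unlike an enumeration, also allows [U n] to be empty; the finite unions
   then still form a nonempty chain. *)
pose V n k := U n `&` [set A | (idx n A < k)%N].
have finV n k : finite_set (V n k).
  have idx_inj : {in V n k &, injective (idx n)}.
    move=> A B /set_mem[/mem_set UA _] /set_mem[/mem_set UB _]; exact: idxP.
  rewrite -(eq_finite_set (inj_card_eq idx_inj)).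
  by apply: sub_finite_set (finite_II k) => _ [A [_ Ak] <-].
have [n|Y [YP coverY]] :=
  A3X (fun n => range (fun k => \bigcup_(A in V n k) A)).
  have [cU mU coverU] := UP n; split.
  - split; first by exists (\bigcup_(A in V n 0%N) A); exists 0%N.
    have mono k l : (k <= l)%N ->
        \bigcup_(A in V n k) A `<=` \bigcup_(A in V n l) A.
      move=> kl; apply: bigcup_subset => A [UA /= Ak]; split=> //=.
      exact: leq_trans kl.
    move=> _ _ [k _ <-] [l _ <-].
    by have [kl|/ltnW lk] := leqP k l; [left|right]; exact: mono.
  - exact: card_le_trans (card_image_le _ _) _.
  - move=> _ [k _ <-].
    apply: (@fin_bigcup_measurable _ (g_sigma_algebraType (@open R))) => //.
    by move=> A [/mU].
  - move=> r /coverU[A UA Ar]; exists (\bigcup_(A in V n (idx n A).+1) A).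
      by exists (idx n A).+1.
    by exists A => //; split=> /=.
have /choice[k kP] : forall n, exists k, \bigcup_(A in V n k) A = Y n.
  by move=> n; have [k _ <-] := YP n; exists k.
exists (fun n => V n (k n)); split=> [n|r /coverY[n _]].
  by split=> // A [].
by rewrite -kP; exists n.
Qed.

Lemma not_dominating_A3 (R : realType) (X : set R) :
  borel_images_not_dominating X -> A3_set X.
Proof.
move=> ndX U UP.
have /choice[A AP] : forall n, exists A : nat -> set R, range A = U n.
  by move=> n; have [[U0 _] cU _ _] := UP n; exact: countable_range.
have UA n i : U n (A n i) by rewrite -AP; exists i.
have firstP (x : X) n : exists i, `[< A n i (set_val x) >].
  have [_ _ _ /(_ _ (set_valP x))[B]] := UP n.
  by rewrite -AP => -[i _ <-] Aix; exists i; apply/asboolP.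
pose Psi (x : X) : baire := fun n => ex_minn (firstP x n).
(* The coordinate fibres are differences of Borel sets, which makes [Psi] Borel. *)
have PsiE (x : X) n k :
    Psi x n = k <-> (A n k `\` \bigcup_(i < k) A n i) (set_val x).
  rewrite /Psi; case: ex_minnP => m /asboolP Am minm; split=> [<-|[Ak nA]].
    by split=> // -[i /= im /asboolP/minm]; rewrite leqNgt im.
  apply/eqP; rewrite eqn_leq minm /=; last exact/asboolP.
  by rewrite leqNgt; apply/negP => mk; apply: nA; exists m.
have /ndX : borel_function Psi.
  pose E n k := A n k `\` \bigcup_(i < k) A n i.
  apply: (@borel_function_coord _ _ _ E _ PsiE) => n k.
  have mA i : borel_set (A n i) by have [_ _ + _] := UP n; apply.
  by apply: borel_setD => //; apply: borel_set_bigcup => i _; exact: mA.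
move=> /existsNP[g gP].
(* As [U n] is a chain, one member contains [A n 0], ..., [A n (g n)]. *)
have /choice[Y YP] : forall n, exists M, U n M /\
    forall i, (i <= g n)%N -> A n i `<=` M.
  move=> n; have [chU _ _ _] := UP n.
  have [||M UM ubM] := chain_finite_ub (F := A n @` `I_(g n).+1) chU.
  - exact: finite_image.
  - by move=> _ [i _ <-].
  by exists M; split=> // i ig; apply: ubM; exists i.
exists Y; split=> [n|r Xr]; first by have [] := YP n.
(* A point missed by every [Y n] has first index above [g n] for all [n], so its image under [Psi]
   would dominate [g]. *)
apply: contrapT => nYr; apply: gP.
pose x : X := exist _ r (mem_set Xr).
exists (Psi x); first by exists x.
apply: nearW => n; rewrite leqNgt; apply/negP => /ltnW Pg; apply: nYr.
exists n => //; apply: (YP n).2 Pg _ _.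
by have /PsiE[] : Psi x n = Psi x n by [].
Qed.

Theorem theorem5 (R : realType) (X : set R) :
  [<-> A3_set X; borel_finite_selection X;
       borel_images_menger X; borel_images_not_dominating X]
  /\ [/\ A3_set X -> menger (set_type X),
         borel_finite_selection X -> menger (set_type X),
         borel_images_menger X -> menger (set_type X)
       & borel_images_not_dominating X -> menger (set_type X)].
Proof.
have fin_images : borel_finite_selection X -> borel_images_menger X.
  move=> selX Psi mPsi; apply: finite_selection_image_menger mPsi selX.
  exact: baire_second_countable.
have images_not_dom : borel_images_menger X -> borel_images_not_dominating X.
  by move=> mX Psi mPsi; apply: menger_not_dominating; exact: mX.
have A3_fin := @A3_finite_selection R X.
have not_dom_A3 := @not_dominating_A3 R X.
have fin_menger := @borel_finite_selection_menger R X.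
(* The four implications close a cycle, and each condition reaches the Menger property through
   finite selection. *)
by split; [tfae | split]; auto.
Qed.
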